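(* Let $\mu\in\mathcal{F}^{10}$ be a filiform Lie bracket of dimension $10$ with parameters $(a_{r,s})_{(r,s)\in\Delta_{10}}$, and let $U^{10}$ be the Zariski open subset of $\mathcal{F}^{10}$ defined by $$a_{1,4}\ne 0,\quad a_{1,5}\ne 0,\quad 3a_{2,6}a_{1,5}(a_{1,4}-a_{2,6})\ne 2a_{2,7}a_{1,4}^2,$$ $$a_{2,6}\ne 0,\quad a_{3,8}\ne 0,\quad a_{1,4}^2+a_{2,7}a_{4,9}\ne 0,\quad 15a_{1,4}^2-a_{2,7}a_{4,9}\ne 0.$$ If $\mu\in U^{10}$, then the filiform Lie bracket $\mu_t=\mu+t\psi_{1,7}$ ($t\in\mathbb{C}$) is not isomorphic to $\mu$, except for $t=0$.
   Context: Let $n=10$ and let $x_0,\dots,x_{n-1}$ be a basis of $\mathbb{C}^n$. Let $\mu_0$ be the alternating bilinear map with $\mu_0(x_0,x_j)=x_{j+1}$ for $1\le j\le n-2$, and $\mu_0(x_i,x_j)=0$ for all other $i<j$. Let $\Delta_n=\{(r,s): 1\le r\le n-2,\ 2r+1<s\le n-1\}\cup\{(\tfrac{n-2}{2},n-1)\}$ (here $n$ is even, so the extra pair is $(4,9)$). For $(r,s)\in\Delta_n$ let $\psi_{r,s}$ be the alternating bilinear map with $$\psi_{r,s}(x_i,x_j)=-\psi_{r,s}(x_j,x_i)=(-1)^{r-i}\binom{j-r-1}{r-i}x_{i+j+s-2r-1}$$ for $1\le i\le r<j\le n-1$ and $i+j+s-2r-1\le n-1$, and $\psi_{r,s}(x_i,x_j)=0$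 otherwise. $\mathcal{F}^n$ is the algebraic set of tuples $(a_{r,s})_{(r,s)\in\Delta_n}$ of complex numbers such that $\psi=\sum_{(r,s)\in\Delta_n}a_{r,s}\psi_{r,s}$ satisfies $\psi(\psi(X,Y),Z)+\psi(\psi(Y,Z),X)+\psi(\psi(Z,X),Y)=0$ for all $X,Y,Z$. The tuple is identified with the filiform Lie bracket $\mu=\mu_0+\psi$ on $\mathbb{C}^n$. A filiform Lie algebra of dimension $n$ is a nilpotent one of maximal class $n-1$. Isomorphic means isomorphic as complex Lie algebras. *)

(* Defs.v *)
From HB Require Import structures.
From mathcomp Require Import all_boot all_order all_algebra.
From mathcomp Require Import reals.
From mathcomp Require Export complex.

Set Implicit Arguments.
Unset Strict Implicit.
Unset Printing Implicit Defensive.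

Import GRing.Theory.
Local Open Scope ring_scope.

(* The basis vector x_k of K^n, 0 <= k <= n-1 (it is 0 when k >= n). *)
Definition basis_vec (K : fieldType) (n k : nat) : 'rV[K]_n :=
  \row_(j < n) (val j == k)%:R.

(* The alternating bilinear map b with b(x_i, x_j) = half i j - half j i.
   In the uses below, at most one of half i j and half j i is nonzero and
   half i i = 0, so that b(x_i, x_j) = half i j = - b(x_j, x_i) whenever
   half i j is given by an explicit formula. *)
Definition alt_ext (K : fieldType) (n : nat) (half : nat -> nat -> 'rV[K]_n)
    (u v : 'rV[K]_n) : 'rV[K]_n :=
  \sum_(i < n) \sum_(j < n) (u 0 i * v 0 j) *: (half i j - half j i).

Definition mu0 (K : fieldType) (n : nat) : 'rV[K]_n -> 'rV[K]_n -> 'rV[K]_n :=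
  alt_ext (fun i j =>
    if (i == 0)%N && (1 <= j <= n - 2)%N then basis_vec K n j.+1 else 0).

Definition Delta (n r s : nat) : bool :=
  [&& 1 <= r <= n - 2, 2 * r + 1 < s & s <= n - 1]%N
  || [&& ~~ odd n, r == (n - 2) %/ 2 & s == n - 1]%N.

(* For (r, s) in Delta n one has 2 * r + 1 <= s, so the truncated subtractions
   below are exact. *)
Definition psi_rs (K : fieldType) (n r s : nat) :
    'rV[K]_n -> 'rV[K]_n -> 'rV[K]_n :=
  alt_ext (fun i j =>
    if [&& 1 <= i <= r, r < j <= n - 1 & i + j + s - (2 * r + 1) <= n - 1]%N
    then ((-1) ^+ (r - i) * 'C(j - r - 1, r - i)%:R)
           *: basis_vec K n (i + j + s - (2 * r + 1))
    else 0).

(* A tuple (a_{r,s}) indexed by Delta n is given by a function of which only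
   the values on Delta n are ever used; Delta n lies in {0, ..., n-1}^2. *)
Definition psi_of (K : fieldType) (n : nat) (a : nat -> nat -> K)
    (u v : 'rV[K]_n) : 'rV[K]_n :=
  \sum_(r < n) \sum_(s < n | Delta n r s) a r s *: psi_rs r s u v.

Definition bracket_of (K : fieldType) (n : nat) (a : nat -> nat -> K)
    (u v : 'rV[K]_n) : 'rV[K]_n :=
  mu0 u v + psi_of a u v.

Definition jacobi (V : zmodType) (b : V -> V -> V) : Prop :=
  forall X Y Z : V, b (b X Y) Z + b (b Y Z) X + b (b Z X) Y = 0.

Definition F_set (K : fieldType) (n : nat) (a : nat -> nat -> K) : Prop :=
  jacobi (@psi_of K n a).

Definition U10 (K : fieldType) (a : nat -> nat -> K) : Prop :=
  F_set 10 a /\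
  [/\ a 1%N 4%N != 0,
      a 1%N 5%N != 0 &
      3%:R * a 2%N 6%N * a 1%N 5%N * (a 1%N 4%N - a 2%N 6%N)
        != 2%:R * a 2%N 7%N * a 1%N 4%N ^+ 2] /\
  [/\ a 2%N 6%N != 0,
      a 3%N 8%N != 0,
      a 1%N 4%N ^+ 2 + a 2%N 7%N * a 4%N 9%N != 0 &
      15%:R * a 1%N 4%N ^+ 2 - a 2%N 7%N * a 4%N 9%N != 0].

Definition lie_bracket (K : fieldType) (V : lmodType K) (b : V -> V -> V) :
    Prop :=
  [/\ forall u, linear (b u),
      forall v, linear (b^~ v),
      forall u, b u u = 0 &
      jacobi b].

(* The span of all b u v with u in U and v in W, for a bilinear b. *)
Definition bracketv (K : fieldType) (V : vectType K) (b : V -> V -> V)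
    (U W : {vspace V}) : {vspace V} :=
  <<[seq b u v | u <- vbasis U, v <- vbasis W]>>%VS.

Definition lower_central (K : fieldType) (V : vectType K) (b : V -> V -> V)
    (k : nat) : {vspace V} :=
  iter k (bracketv b fullv) fullv.

Definition nilpotent_of_class (K : fieldType) (V : vectType K)
    (b : V -> V -> V) (c : nat) : Prop :=
  lower_central b c = 0%VS /\
  forall k, (k < c)%N -> lower_central b k <> 0%VS.

Definition filiform_lie_bracket (K : fieldType) (V : vectType K)
    (b : V -> V -> V) : Prop :=
  lie_bracket b /\ nilpotent_of_class b (\dim (fullv : {vspace V})).-1.

Definition lie_isomorphic (K : fieldType) (V W : lmodType K)
    (b : V -> V -> V) (c : W -> W -> W) : Prop :=
  exists f : {linear V -> W},
    bijective f /\ forall u v, f (b u v) = c (f u) (f v).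

(* Main.v *)
(* Let f be an isomorphism from mu_t to mu, and write p and q for the
   coordinates of f(x_0) and f(x_1).  As f(x_{j+1}) = mu(f(x_0), f(x_j)), these
   determine f; injectivity of f makes it triangular with q_0 = 0.  The lowest
   coefficients of the images of [x_1, x_2] and [x_2, x_3] give q_1 = p_0^2 and
   two linear relations between p_1 and p_0 (1 - p_0), whose determinant is
   nonzero by the third condition of U^10: hence p_0 = q_1 = 1 and p_1 = 0.
   The next coefficients give q_3 = q_2^2 / 2, express t as - a_{2,6} d, and
   yield a homogeneous 2x2 linear system in d and e; these reduce to 3 q_4 and
   2 q_5 when q_2 and the p_k, k >= 2, vanish, which could be achieved by an
   inner automorphism.  If a_{4,9} = 0, then a_{3,8} d = 0.  Otherwise the
   Jacobi relations force a_{2,6} = a_{1,4} or a_{2,6} = - a_{1,4}, and the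
   determinant is, up to sign, a_{1,4}^2 + a_{2,7} a_{4,9} in the first case and
   15 a_{1,4}^2 - a_{2,7} a_{4,9} in the second.  So d = 0 and t = 0. *)
Require Import Defs.
From HB Require Import structures.
From mathcomp Require Import all_boot all_order all_algebra.
From mathcomp Require Import reals.
From mathcomp Require Import ring.

Set Implicit Arguments.
Unset Strict Implicit.
Unset Printing Implicit Defensive.

Import GRing.Theory Num.Theory.
Local Open Scope ring_scope.

(** * Coordinates of the bracket and the Jacobi relations *)

Section Coordinates.
Variable K : fieldType.

(* Used with [l = r] a linear combination of known equations; the last premise
   is then a [ring] identity. *)
Lemma scaled_eq (c u v l r : K) :
  c != 0 -> l = r -> c * (u - v) = l - r -> u = v.
Proof.
move=> c0 -> /eqP; rewrite subrr mulf_eq0 (negPf c0) /= => /eqP.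
exact: subr0_eq.
Qed.

(* Only meaningful for [k <= n]: otherwise [inord k] is [0]. *)
Definition entry n (u : 'rV[K]_n.+1) (k : nat) : K := u 0 (inord k).

Lemma entry_ord n (u : 'rV[K]_n.+1) (i : 'I_n.+1) : u 0 i = entry u i.
Proof. by rewrite /entry inord_val. Qed.

Lemma entryP n (u v : 'rV[K]_n.+1) :
  (forall k, (k <= n)%N -> entry u k = entry v k) -> u = v.
Proof. by move=> E; apply/rowP => i; rewrite !entry_ord E // -ltnS. Qed.

Lemma entry0 n k : entry (0 : 'rV[K]_n.+1) k = 0.
Proof. exact: mxE. Qed.

Lemma entry_basis_vec n i k : (k <= n)%N ->
  entry (basis_vec K n.+1 i) k = (k == i)%:R.
Proof. by move=> le_kn; rewrite /entry mxE /= inordK. Qed.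

Lemma entryD n (u v : 'rV[K]_n.+1) k : entry (u + v) k = entry u k + entry v k.
Proof. exact: mxE. Qed.

Lemma entryZ n c (u : 'rV[K]_n.+1) k : entry (c *: u) k = c * entry u k.
Proof. exact: mxE. Qed.

Lemma entry_sum n I (r : seq I) (P : pred I) (F : I -> 'rV[K]_n.+1) k :
  entry (\sum_(i <- r | P i) F i) k = \sum_(i <- r | P i) entry (F i) k.
Proof. exact: summxE. Qed.

Lemma row_basis_vec n (u : 'rV[K]_n.+1) :
  u = \sum_(0 <= i < n.+1) entry u i *: basis_vec K n.+1 i.
Proof.
apply: entryP => k le_kn; rewrite entry_sum.
under eq_bigr do rewrite entryZ entry_basis_vec // eq_sym mulr_natr mulrb.
by rewrite -big_mkcond big_nat1_eq ltnS le_kn.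
Qed.

Lemma entry_alt_ext n half (u v : 'rV[K]_n.+1) k :
  entry (alt_ext half u v) k =
  \sum_(0 <= i < n.+1) \sum_(0 <= j < n.+1)
    entry (half i j) k * (entry u i * entry v j - entry u j * entry v i).
Proof.
rewrite big_mkord /alt_ext entry_sum.
transitivity (\sum_(i < n.+1) \sum_(j < n.+1)
    (entry (half i j) k * (entry u i * entry v j)
     - entry (half j i) k * (entry u i * entry v j))).
  apply: eq_bigr => i _; rewrite entry_sum; apply: eq_bigr => j _.
  by rewrite entryZ !entry_ord -mulrBl mulrC /entry !mxE.
have sumB2 (F G : 'I_n.+1 -> 'I_n.+1 -> K) : \sum_i \sum_j (F i j - G i j) =
    \sum_i \sum_j F i j - \sum_i \sum_j G i j.
  by rewrite -sumrB; apply: eq_bigr => i _; rewrite sumrB.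
rewrite sumB2 [X in _ - X]exchange_big -sumB2.
apply: eq_bigr => i _; rewrite big_mkord; apply: eq_bigr => j _.
by rewrite mulrBr.
Qed.

Definition ipairs n := [seq (i, j) | i <- index_iota 0 n, j <- index_iota 0 n].

Lemma sum_allpairs I J (r : seq I) (t : seq J) (F : I * J -> K) :
  \sum_(p <- [seq (i, j) | i <- r, j <- t]) F p =
  \sum_(i <- r) \sum_(j <- t) F (i, j).
Proof. exact: big_allpairs. Qed.

Lemma big_ipairs n (P : rel nat) (F : nat -> nat -> K) :
  \sum_(0 <= i < n) \sum_(0 <= j < n | P i j) F i j =
  \sum_(p <- ipairs n | P p.1 p.2) F p.1 p.2.
Proof.
rewrite [RHS]big_mkcond sum_allpairs.
by apply: eq_bigr => i _; rewrite big_mkcond.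
Qed.

(* The tuples [(r, s, i, j, r - i, 'C(j - r - 1, r - i))] contributing to the
   coefficient of x_k in psi; for fixed [n] and [k] the list is computed. *)
Definition psi_terms n k :=
  [seq (p.1.1, p.1.2, p.2.1, p.2.2, (p.1.1 - p.2.1)%N,
       'C(p.2.2 - p.1.1 - 1, p.1.1 - p.2.1))
  | p <- [seq (p, q) | p <- ipairs n, q <- ipairs n]
  & let: (r, s, (i, j)) := p in
    [&& Delta n r s, 1 <= i <= r, r < j <= n - 1
      & i + j + s - (2 * r + 1) == k]%N].

(** Flattening the four nested sums into one over a list lets [entry_bracket_of] obtain the explicit
    coefficients by computation. *)
Lemma entry_psi_of n a (u v : 'rV[K]_n.+1) k : (k <= n)%N ->
  entry (psi_of a u v) k =
  \sum_(e <- psi_terms n.+1 k) (let: (r, s, i, j, m, c) := e in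
    a r s * ((-1) ^+ m * c%:R
             * (entry u i * entry v j - entry u j * entry v i))).
Proof.
move=> le_kn; rewrite /psi_of entry_sum.
under eq_bigr do (rewrite entry_sum;
  under eq_bigr do rewrite entryZ entry_alt_ext).
pose F r s := a r s *
  \sum_(p <- ipairs n.+1) entry (if [&& 0 < p.1 <= r, r < p.2 <= n.+1 - 1
     & p.1 + p.2 + s - (2 * r + 1) <= n.+1 - 1]%N
     then ((-1) ^+ (r - p.1) * 'C(p.2 - r - 1, r - p.1)%:R) *:
          basis_vec K n.+1 (p.1 + p.2 + s - (2 * r + 1)) else 0) k
     * (entry u p.1 * entry v p.2 - entry u p.2 * entry v p.1).
transitivity (\sum_(0 <= r < n.+1) \sum_(0 <= s < n.+1 | Delta n.+1 r s) F r s).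
  rewrite big_mkord; apply: eq_bigr => r _.
  rewrite big_mkord; apply: eq_bigr => s _.
  by rewrite big_ipairs.
rewrite big_ipairs [LHS]big_mkcond big_map big_filter.
rewrite [RHS]big_mkcond [RHS]sum_allpairs.
apply: eq_bigr => -[r s] _ /=.
case: (Delta n.+1 r s) => /=; last by rewrite big1 // => -[].
rewrite /F big_distrr /=; apply: eq_bigr => -[i j] _ /=.
rewrite !subn1 /=.
case: ifP => [/and3P[-> -> lek]|nc].
  rewrite entryZ entry_basis_vec // eq_sym /=.
  by case: eqP => _; rewrite ?mulr1 ?mulr0 ?mul0r ?mulr0.
rewrite {1}/entry mxE mul0r mulr0; case: ifP => // /and3P[ci cj /eqP kE].
by move: nc; rewrite ci cj kE le_kn.
Qed.

Lemma entry_mu0 n (u v : 'rV[K]_n.+1) k : (k <= n)%N ->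
  entry (mu0 u v) k =
  if (2 <= k)%N then entry u 0 * entry v k.-1 - entry u k.-1 * entry v 0 else 0.
Proof.
move=> le_kn; rewrite entry_alt_ext big_ltn // [X in _ + X]big_nat.
rewrite [X in _ + X]big1 ?addr0; last first.
  move=> [|i] // _; rewrite big1 // => j _.
  by rewrite /= {1}/entry mxE mul0r.
rewrite (eq_bigr (fun j => if j == k.-1 then
    if (2 <= k)%N then entry u 0 * entry v j - entry u j * entry v 0 else 0
    else 0)).
  rewrite -big_mkcond big_nat1_eq.
  by case: k le_kn => [|k] //= /ltnW; rewrite -ltnS => ->.
move=> j _ /=; case: ifP => [/andP[j0 jn]|jn].
  rewrite entry_basis_vec //; case: k le_kn => [|k] le_kn /=.
    by rewrite mul0r; case: ifP.
  rewrite eqSS [k == j]eq_sym; case: eqP j0 => [->|_] j0; last by rewrite mul0r.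
  by rewrite ltnS j0 mul1r.
rewrite {1}/entry mxE mul0r; case: eqP => [jE|//]; case: ifP => // k2.
move: jn; rewrite jE; case: k k2 le_kn {jE} => [|[|k]] //= _ le_kn.
by rewrite leq_subRL ?add2n ?ltnS ?le_kn // (leq_trans _ le_kn).
Qed.

(* The coefficient of x_k in mu(u, v) for n = 10, where [x] and [y] are the
   coordinate sequences of u and v. *)
Definition bracket_coord (a : nat -> nat -> K) (x y : nat -> K) (k : nat) : K :=
  let w i j := x i * y j - x j * y i in
  match k with
  | 2 => w 0 1
  | 3 => w 0 2
  | 4 => w 0 3 + a 1 4 * w 1 2
  | 5 => w 0 4 + a 1 5 * w 1 2 + a 1 4 * w 1 3
  | 6 => w 0 5 + a 1 6 * w 1 2 + a 1 5 * w 1 3 + (a 1 4 - a 2 6) * w 1 4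
      + a 2 6 * w 2 3
  | 7 => w 0 6 + a 1 7 * w 1 2 + a 1 6 * w 1 3 + (a 1 5 - a 2 7) * w 1 4
      + (a 1 4 - 2 * a 2 6) * w 1 5 + a 2 7 * w 2 3 + a 2 6 * w 2 4
  | 8 => w 0 7 + a 1 8 * w 1 2 + a 1 7 * w 1 3 + (a 1 6 - a 2 8) * w 1 4
      + (a 1 5 - 2 * a 2 7) * w 1 5 + (a 1 4 + a 3 8 - 3 * a 2 6) * w 1 6
      + a 2 8 * w 2 3 + a 2 7 * w 2 4 + (a 2 6 - a 3 8) * w 2 5
      + a 3 8 * w 3 4
  | 9 => w 0 8 + a 1 9 * w 1 2 + a 1 8 * w 1 3 + (a 1 7 - a 2 9) * w 1 4
      + (a 1 6 - 2 * a 2 8) * w 1 5 + (a 1 5 + a 3 9 - 3 * a 2 7) * w 1 6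
      + (a 1 4 + 3 * a 3 8 - 4 * a 2 6) * w 1 7 + (- a 4 9) * w 1 8
      + a 2 9 * w 2 3 + a 2 8 * w 2 4 + (a 2 7 - a 3 9) * w 2 5
      + (a 2 6 - 2 * a 3 8) * w 2 6 + a 4 9 * w 2 7 + a 3 9 * w 3 4
      + a 3 8 * w 3 5 + (- a 4 9) * w 3 6 + a 4 9 * w 4 5
  | _ => 0
  end.

Lemma entry_bracket_of a (u v : 'rV[K]_10) k : (k < 10)%N ->
  entry (bracket_of a u v) k = bracket_coord a (entry u) (entry v) k.
Proof.
move=> lt_k10; rewrite entryD entry_mu0 // entry_psi_of //.
do 10?[case: k lt_k10 => [|k] lt_k10] => //=;
match goal with |- context [psi_terms 10 ?m] =>
  let s := eval vm_compute in (psi_terms 10 m) in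
  rewrite (_ : psi_terms 10 m = s); last by vm_compute
end; rewrite ?big_cons big_nil; ring.
Qed.

Lemma bracket_coord_le1 a (y z : nat -> K) k :
  (k <= 1)%N -> bracket_coord a y z k = 0.
Proof. by case: k => [|[]]. Qed.

(** Every term of coefficient k involves only coordinates of index below k. So vectors known up to
    some index can be replaced by explicit lists. *)
Lemma eq_bracket_coord a n (y y' z z' : nat -> K) k :
    (forall i, (i < n)%N -> y i = y' i) ->
    (forall i, (i < n)%N -> z i = z' i) -> (k <= n)%N ->
  bracket_coord a y z k = bracket_coord a y' z' k.
Proof.
move=> eqy eqz le_kn.
have {}eqy i : (i < k)%N -> y i = y' i.
  by move=> lt_ik; apply/eqy/(leq_trans lt_ik).
have {le_kn} {}eqz i : (i < k)%N -> z i = z' i.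
  by move=> lt_ik; apply/eqz/(leq_trans lt_ik).
by do 10?[case: k eqy eqz => [|k] eqy eqz] => //=; rewrite !(eqy, eqz).
Qed.

Lemma eq_bracket_coordr a n (y z z' : nat -> K) k :
    (forall i, (i < n)%N -> z i = z' i) -> (k <= n)%N ->
  bracket_coord a y z k = bracket_coord a y z' k.
Proof. by move=> eqz; apply: eq_bracket_coord. Qed.

Lemma bracket_coord_eq0 a (y z : nat -> K) k :
  (forall i, (i < k)%N -> z i = 0) -> bracket_coord a y z k = 0.
Proof.
move=> z0; rewrite (@eq_bracket_coordr a k y z (fun=> 0)) // {z0}.
by do 10?[case: k => [|k] //=]; rewrite ?(mulr0, mul0r, subr0, addr0).
Qed.

(* The equations defining F^10; none of them involves a_{1,7}, so they also hold
   for mu_t. *)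
Definition jacobi_eqs (a : nat -> nat -> K) : Prop :=
  [/\ 3 * a 2 6 ^+ 2 = a 3 8 * (2 * a 1 4 + a 2 6),
      2 * a 1 4 * a 3 9 + 3 * a 1 5 * a 3 8 + a 2 6 * a 3 9 + 3 * a 2 7 * a 3 8
      = 2 * a 1 6 * a 4 9 + 7 * a 2 6 * a 2 7 + a 2 8 * a 4 9
    & a 4 9 * (2 * a 1 4 - a 2 6 - a 3 8) = 0].

(** Each term of [mu0 u v] has a factor [entry u 0] or [entry v 0]. Off x_0, the Jacobi identity of
    psi can thus be read off [bracket_coord]. *)
Lemma psi_of_bracket_of a (u v : 'rV[K]_10) : entry u 0 = 0 -> entry v 0 = 0 ->
  psi_of a u v = bracket_of a u v.
Proof.
move=> u0 v0; rewrite /bracket_of [mu0 u v](_ : _ = 0) ?add0r //.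
apply: entryP => k le_k9; rewrite entry_mu0 // entry0 u0 v0 mul0r mulr0 subr0.
by case: ifP.
Qed.

Lemma jacobi_eqsP a : F_set 10 a -> jacobi_eqs a.
Proof.
move=> Fa; pose e (i m : nat) : K := (m == i)%:R.
have J i j k l : (0 < i)%N -> (0 < j)%N -> (0 < k)%N -> (l < 10)%N ->
    bracket_coord a (bracket_coord a (e i) (e j)) (e k) l
    + bracket_coord a (bracket_coord a (e j) (e k)) (e i) l
    + bracket_coord a (bracket_coord a (e k) (e i)) (e j) l = 0.
  move=> i0 j0 k0 l10.
  have entry_e m n : (n < 10)%N -> entry (basis_vec K 10 m) n = e m n.
    by move=> n10; rewrite entry_basis_vec.
  have e0 m : (0 < m)%N -> entry (basis_vec K 10 m) 0 = 0.
    by move=> m0; rewrite entry_e // /e eq_sym (negPf (lt0n_neq0 m0)).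
  have bE m n r (m0 : (0 < m)%N) (n0 : (0 < n)%N) (r0 : (0 < r)%N) :
      entry (psi_of a (psi_of a (basis_vec K 10 m) (basis_vec K 10 n))
        (basis_vec K 10 r)) l =
      bracket_coord a (bracket_coord a (e m) (e n)) (e r) l.
    rewrite !psi_of_bracket_of ?e0 ?entry_bracket_of //.
    have b_e s : (s < 10)%N -> entry (bracket_of a (basis_vec K 10 m)
        (basis_vec K 10 n)) s = bracket_coord a (e m) (e n) s.
      move=> s10; rewrite entry_bracket_of //.
      by apply: (eq_bracket_coord _ (entry_e m) (entry_e n)); apply: ltnW.
    by apply: (eq_bracket_coord _ b_e (entry_e r)); apply: ltnW.
  by rewrite -!bE // -2!entryD Fa entry0.
split.
- apply: scaled_eq (oner_neq0 _) (J 1 2 3 8 isT isT isT isT) _.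
  by rewrite /e /=; ring.
- apply: scaled_eq (oner_neq0 _) (esym (J 1 2 3 9 isT isT isT isT)) _.
  by rewrite /e /=; ring.
apply: scaled_eq (oner_neq0 _) (J 1 2 5 9 isT isT isT isT) _.
by rewrite /e /=; ring.
Qed.

End Coordinates.

(** * The bracket is a filiform Lie bracket *)

Lemma linear_span (K : fieldType) (V W : vectType K) (g : V -> W) (X : seq V)
    (S : {vspace W}) :
  linear g -> (forall x, x \in X -> g x \in S) ->
  forall v, v \in <<X>>%VS -> g v \in S.
Proof.
move=> lin_g gX v; pose gL := GRing.isLinear.Build K V W *:%R g lin_g.
pose h : {linear V -> W} := HB.pack g gL.
have /subvP sXS : (<<X>> <= linfun h @^-1: S)%VS.
  by apply/span_subvP => x xX; rewrite -memv_preim lfunE gX.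
by move/sXS; rewrite -memv_preim lfunE.
Qed.

Lemma memv_bracketv (K : fieldType) (V : vectType K) (b : V -> V -> V)
    (U W : {vspace V}) u w :
    (forall u, linear (b u)) -> (forall w, linear (b^~ w)) ->
  u \in U -> w \in W -> b u w \in bracketv b U W.
Proof.
move=> linr linl; rewrite -{1}(span_basis (vbasisP U)).
rewrite -{1}(span_basis (vbasisP W)) => uU wW.
apply: (linear_span (linl w)) uU => x xU.
apply: (linear_span (linr x)) wW => y yW.
by apply/memv_span/allpairsP; exists (x, y).
Qed.

Section Filiform.
Variable K : fieldType.
Variables (a : nat -> nat -> K) (b : 'rV[K]_10 -> 'rV[K]_10 -> 'rV[K]_10).
Hypothesis bE : forall u v k, (k < 10)%N ->
  entry (b u v) k = bracket_coord a (entry u) (entry v) k.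

Lemma linear_bracket u : linear (b u).
Proof.
move=> c v w; apply: entryP => k le_k9; rewrite entryD entryZ !bE //.
do 10?[case: k le_k9 => [|k] le_k9 //]; rewrite /= ?(entryD, entryZ); ring.
Qed.

Lemma bracket_skew u v : b u v = - b v u.
Proof.
apply: entryP => k le_k9; rewrite -scaleN1r entryZ !bE //.
by do 10?[case: k le_k9 => [|k] le_k9 //]; rewrite /=; ring.
Qed.

Lemma linear_bracketl v : linear (b^~ v).
Proof.
move=> c u w /=; rewrite bracket_skew linear_bracket opprD -scalerN.
by rewrite -!(bracket_skew _ v).
Qed.

(** The Jacobiator is alternating and trilinear, so its coefficients are combinations of 3x3 minors
    of X, Y, Z. They vanish identically below x_8; at x_8 and x_9 the minors [det i j k] multiply
    the three relations. *)
Lemma lie_bracketP : jacobi_eqs a -> lie_bracket b.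
Proof.
move=> [J1 J2 J3]; split; [exact: linear_bracket | exact: linear_bracketl | |].
  move=> u; apply: entryP => k le_k9; rewrite entry0 bE //.
  by do 10?[case: k le_k9 => [|k] le_k9 //]; rewrite /=; ring.
move=> X Y Z; apply: entryP => k le_k9.
rewrite entry0 !entryD !bE //.
pose x := entry X; pose y := entry Y; pose z := entry Z.
pose det i j k := x i * (y j * z k - y k * z j) - x j * (y i * z k - y k * z i)
  + x k * (y i * z j - y j * z i).
case: (ltnP k 8) => [|le_8k].
  clear le_k9; by do 8?[case: k => [|k] //]; rewrite /= ?bE //= => _; ring.
case: (ltngtP k 8) le_8k => // [lt_8k|->] _ /=; rewrite ?bE //=.
  have -> : k = 9 by apply/eqP; rewrite eqn_leq le_k9.
  rewrite /= !bE //=.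
  have E := f_equal2 +%R (f_equal2 +%R (congr1 ( *%R (det 1 2 4)) J1)
      (congr1 ( *%R (- det 1 2 3)) J2))
    (congr1 ( *%R (det 1 2 5 - det 1 3 4)) J3).
  by apply: scaled_eq (oner_neq0 _) E _; rewrite /det /x /y /z; ring.
apply: scaled_eq (oner_neq0 _) (congr1 ( *%R (det 1 2 3)) J1) _.
rewrite /det /x /y /z; ring.
Qed.

Lemma bracket_basis0 i : (0 < i < 9)%N ->
  b (basis_vec K 10 0) (basis_vec K 10 i) = basis_vec K 10 i.+1.
Proof.
move=> hi; apply: entryP => k le_k9; rewrite bE // !entry_basis_vec //.
do 9?[case: i hi => [|i] // hi]; do 10?[case: k le_k9 => [|k] le_k9 //];
by rewrite /= !entry_basis_vec //=; ring.
Qed.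

Lemma mem_lower_central i : (i < 9)%N ->
  basis_vec K 10 i.+1 \in lower_central b i.
Proof.
elim: i => [|i IHi] lt_i9; first exact: memvf.
rewrite -bracket_basis0 //.
apply: memv_bracketv; rewrite ?memvf ?IHi 1?ltnW //.
  exact: linear_bracket.
exact: linear_bracketl.
Qed.

(** Each bracketing raises the lowest index, and the first one already removes both x_0 and x_1;
    hence class 9 rather than 10. *)
Lemma lower_central_entry i v : (0 < i)%N -> v \in lower_central b i ->
  forall k, (k <= i)%N -> (k < 10)%N -> entry v k = 0.
Proof.
elim: i v => // i IHi v _ v_lc k le_ki lt_k10.
(* Vanishing is phrased as membership in the zero subspace so that [linear_span] reduces it to
   generators. *)
suff: (entry v k : K^o) \in (0%VS : {vspace K^o}) by rewrite memv0 => /eqP.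
have lin_entry : linear (fun v : 'rV[K]_10 => entry v k : K^o).
  by move=> c u w /=; rewrite entryD entryZ.
apply: (linear_span lin_entry) v_lc => _ /allpairsP[[u w] [_ /= w_lc ->]].
rewrite memv0 bE //; apply/eqP.
case: i IHi le_ki w_lc => [|i] IHi le_ki w_lc; first exact: bracket_coord_le1.
apply: bracket_coord_eq0 => j lt_jk; apply: (IHi _ isT (vbasis_mem w_lc)).
  by rewrite -ltnS (leq_trans lt_jk).
exact: ltn_trans lt_k10.
Qed.

Lemma nilpotent_bracket : nilpotent_of_class b 9.
Proof.
split=> [|k lt_k9].
  apply/eqP; rewrite -subv0; apply/subvP => v v_lc; rewrite memv0; apply/eqP.
  apply: entryP => k le_k9; rewrite entry0.
  exact: (lower_central_entry _ v_lc).
move=> lc0; have := mem_lower_central lt_k9; rewrite lc0 memv0 => /eqP.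
move=> /(congr1 (@entry _ _ ^~ k.+1)).
by rewrite entry_basis_vec // entry0 eqxx => /eqP; rewrite oner_eq0.
Qed.

Lemma filiform_bracket : jacobi_eqs a -> filiform_lie_bracket b.
Proof.
move=> Ja; split; first exact: lie_bracketP.
have -> : (\dim {:'rV[K]_10}).-1 = 9 by rewrite dimvf.
exact: nilpotent_bracket.
Qed.

End Filiform.

(** * The deformation as a change of parameters *)

Section Shift.
Variable K : fieldType.

Lemma psi_ofDl n (a c : nat -> nat -> K) (u v : 'rV[K]_n) :
  psi_of (fun r s => a r s + c r s) u v = psi_of a u v + psi_of c u v.
Proof.
rewrite -big_split; apply: eq_bigr => r _; rewrite -big_split.
by apply: eq_bigr => s _; rewrite scalerDl.
Qed.

Lemma psi_of_single n r s (t : K) (u v : 'rV[K]_n) :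
    (r < n)%N -> (s < n)%N -> Delta n r s ->
  psi_of (fun r' s' => if (r' == r) && (s' == s) then t else 0) u v =
  t *: psi_rs r s u v.
Proof.
move=> lt_rn lt_sn D.
rewrite /psi_of (bigD1 (Ordinal lt_rn)) //= (bigD1 (Ordinal lt_sn)) //= !eqxx.
rewrite !big1 ?addr0 // => [i ne|i /andP[_ ne]]; last first.
  by rewrite -val_eqE /= in ne; rewrite (negPf ne) scale0r.
rewrite -val_eqE /= in ne; rewrite (negPf ne) big1 // => j _; exact: scale0r.
Qed.

Definition shift17 (a : nat -> nat -> K) t r s :=
  a r s + if (r == 1) && (s == 7) then t else 0.

Lemma entry_shift17 a t (u v : 'rV[K]_10) k : (k < 10)%N ->
  entry (bracket_of a u v + t *: psi_rs 1 7 u v) k =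
  bracket_coord (shift17 a t) (entry u) (entry v) k.
Proof.
move=> lt_k10; rewrite -entry_bracket_of // /bracket_of psi_ofDl.
by rewrite psi_of_single // addrA.
Qed.

End Shift.

(** * Coordinates of an isomorphism from mu_t to mu *)

Section Rigidity.
Variable K : numFieldType.
Variables (a : nat -> nat -> K) (t : K) (x : nat -> nat -> K).
Notation p := (x 0).
Notation q := (x 1).

(* [x j] stands for the coordinate sequence of f(x_j). *)
Hypothesis Ua : U10 a.
Hypothesis Ex : forall j l, (0 < j < 9)%N -> (l < 10)%N ->
  x j.+1 l = bracket_coord a p (x j) l.
(** Since psi_{1,7} vanishes on (x_2, x_3), the parameter t enters the image of [x_1, x_2] but not
    that of [x_2, x_3]. *)
Hypothesis E12 : forall l, (l < 10)%N ->
  bracket_coord a q (x 2) l =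
  a 1 4 * x 4 l + a 1 5 * x 5 l + a 1 6 * x 6 l + (a 1 7 + t) * x 7 l
  + a 1 8 * x 8 l + a 1 9 * x 9 l.
Hypothesis E23 : forall l, (l < 10)%N ->
  bracket_coord a (x 2) (x 3) l =
  a 2 6 * x 6 l + a 2 7 * x 7 l + a 2 8 * x 8 l + a 2 9 * x 9 l.

Lemma image_triangular j l : (1 < j < 10)%N -> (l < j)%N -> x j l = 0.
Proof.
elim: j l => [|[|[|j]] IHj] l //.
  by move=> _ l2; rewrite Ex ?bracket_coord_le1 // (leq_trans l2).
move=> lt_j10 lt_lj; rewrite Ex //; last exact: (leq_trans lt_lj (ltnW lt_j10)).
apply: bracket_coord_eq0 => i lt_il.
rewrite IHj //; last exact: leq_trans lt_il _.
exact: (ltnW lt_j10).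
Qed.

(** In this range only mu_0 raises an index by exactly one. From x_8 to x_9, psi_{4,9} adds the term
    - a_{4,9} p_1. *)
Lemma image_diagS j : (1 < j < 8)%N -> x j.+1 j.+1 = p 0 * x j j.
Proof.
move=> /andP[j1 j8].
have z i : (i < j.+1)%N -> x j i = if i == j then x j j else 0.
  rewrite ltnS leq_eqVlt; case: eqP => [->|_] //=.
  by apply: image_triangular; rewrite j1 (leq_trans j8).
have j9 : (j < 9)%N by rewrite (leq_trans j8).
rewrite Ex ?(ltnW j1) ?ltnS // (eq_bracket_coordr _ _ z) //.
by clear z j9; do 8?[case: j j1 j8 => [|j] // j1 j8] => /=; ring.
Qed.

Hypothesis x99 : x 9 9 != 0.

Lemma image_leading : [/\ p 0 != 0, q 0 = 0 & q 1 != 0].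
Proof.
have : x 9 9 = p 0 ^+ 6 * x 2 2 * (p 0 - a 4 9 * p 1).
  have z i : (i < 9)%N -> x 8 i = if i == 8 then x 8 8 else 0.
    by rewrite ltnS leq_eqVlt; case: eqP => [->|_] //=; apply: image_triangular.
  have -> : p 0 ^+ 6 * x 2 2 = x 8 8.
    by rewrite !(image_diagS (j := 7), image_diagS (j := 6),
      image_diagS (j := 5), image_diagS (j := 4), image_diagS (j := 3),
      image_diagS (j := 2)) //; ring.
  by rewrite Ex // (eq_bracket_coordr _ _ z) //=; ring.
move=> E; have [p0 d0] : p 0 != 0 /\ x 2 2 != 0.
  by split; apply: contraNneq x99 => e0; rewrite E e0; apply/eqP; ring.
(* The image of [x_1, x_2] starts at x_4, so its x_3 coefficient, q_0 times [x 2 2], is zero. *)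
have q00 : q 0 = 0.
  apply/eqP; move: (@E12 3 isT) => /=; rewrite !(image_triangular (l := 3)) //.
  rewrite (image_triangular (j := 2) (l := 0)) // !mulr0 !addr0 subr0 => /eqP.
  by rewrite mulf_eq0 (negPf d0) orbF.
split=> //; apply: contraNneq d0 => q10.
by rewrite Ex //= q00 q10; apply/eqP; ring.
Qed.

Lemma image_unipotent : [/\ p 0 = 1, p 1 = 0, q 0 = 0 & q 1 = 1].
Proof.
have [_ [[a14 _ scale_nz] [a26 _ _ _]]] := Ua.
have [p0 q0 q1] := image_leading.
(* The tables record the two lowest coefficients of each image; [x 2 4] stays unexpanded because it
   only meets zero factors. *)
have x2 l : (l < 5)%N -> x 2 l = [:: 0; 0; p 0 * q 1; p 0 * q 2; x 2 4]`_l.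
  by do 5?case: l => [|l] //; move=> _; rewrite [LHS]Ex //= ?q0; ring.
have x3 l : (l < 5)%N -> x 3 l = [:: 0; 0; 0; p 0 ^+ 2 * q 1;
    p 0 ^+ 2 * q 2 + a 1 4 * p 0 * p 1 * q 1]`_l.
  by do 5?case: l => [|l] //; move=> _;
    rewrite Ex // (eq_bracket_coordr _ _ x2) //=; ring.
have x4 l : (l < 6)%N -> x 4 l = [:: 0; 0; 0; 0; p 0 ^+ 3 * q 1;
    p 0 ^+ 3 * q 2 + 2 * a 1 4 * p 0 ^+ 2 * p 1 * q 1]`_l.
  by do 6?case: l => [|l] //; move=> _;
    rewrite Ex // (eq_bracket_coordr _ _ x3) //=; ring.
have x5 l : (l < 7)%N -> x 5 l = [:: 0; 0; 0; 0; 0; p 0 ^+ 4 * q 1;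
    p 0 ^+ 4 * q 2 + (3 * a 1 4 - a 2 6) * p 0 ^+ 3 * p 1 * q 1]`_l.
  by do 7?case: l => [|l] //; move=> _;
    rewrite Ex // (eq_bracket_coordr _ _ x4) //=; ring.
have x6 l : (l < 8)%N -> x 6 l = [:: 0; 0; 0; 0; 0; 0; p 0 ^+ 5 * q 1;
    p 0 ^+ 5 * q 2 + (4 * a 1 4 - 3 * a 2 6) * p 0 ^+ 4 * p 1 * q 1]`_l.
  by do 8?case: l => [|l] //; move=> _;
    rewrite Ex // (eq_bracket_coordr _ _ x5) //=; ring.
have q1E : q 1 = p 0 ^+ 2.
  have E := @E12 4 isT; rewrite (eq_bracket_coordr _ _ x2) //= q0 x4 //= in E.
  rewrite !(image_triangular (l := 4)) // in E.
  by apply: scaled_eq (_ : a 1 4 * p 0 * q 1 != 0) E _;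
    [rewrite !mulf_neq0 | ring].
(* The unknown q_2 cancels here and again in [E2]. *)
have E1 : a 1 5 * (1 - p 0) * p 0 = 2 * a 1 4 ^+ 2 * p 1.
  have E := @E12 5 isT.
  rewrite (eq_bracket_coordr _ _ x2) //= q0 x4 // x5 //= q1E in E.
  rewrite !(image_triangular (l := 5)) // in E.
  by apply: scaled_eq (_ : p 0 ^+ 4 != 0) E _; [rewrite expf_neq0 | ring].
have E2 : a 2 7 * (1 - p 0) * p 0 = 3 * a 2 6 * (a 1 4 - a 2 6) * p 1.
  have E := @E23 7 isT; rewrite /= (image_diagS (j := 6)) // !x6 //= in E.
  rewrite !(x2 0, x2 1, x2 2, x3 0, x3 1, x3 2, x3 3, x3 4) //= q1E in E.
  rewrite !(image_triangular (l := 7)) // in E.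
  by apply: scaled_eq (_ : p 0 ^+ 6 != 0) E _; [rewrite expf_neq0 | ring].
have p0E : p 0 = 1.
  (* Up to sign, p_0 times the determinant of [E1] and [E2] as a system in p_0 (1 - p_0) and p_1. *)
  have nz : p 0 * (3 * a 2 6 * a 1 5 * (a 1 4 - a 2 6) - 2 * a 2 7 * a 1 4 ^+ 2)
      != 0 by rewrite mulf_neq0 // subr_eq0.
  have E : 2 * a 1 4 ^+ 2 * (a 2 7 * (1 - p 0) * p 0) =
      3 * a 2 6 * (a 1 4 - a 2 6) * (a 1 5 * (1 - p 0) * p 0).
    by rewrite E1 E2; ring.
  by apply: scaled_eq nz E _; ring.
split=> //; last by rewrite q1E p0E expr1n.
apply: scaled_eq (_ : - (2 * a 1 4 ^+ 2) != 0) E1 _; last by rewrite p0E; ring.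
by rewrite oppr_eq0 mulf_neq0 ?pnatr_eq0 ?expf_neq0.
Qed.

(** No normalization by an inner automorphism is made: all p_k and q_k are carried along, and the
    surplus terms turn out to be multiples of the Jacobi relations. *)
Lemma shift_system : exists d e,
  [/\ t = - (a 2 6 * d), a 4 9 * e = a 3 8 * d
    & (a 3 8 - 2 * a 2 6) * e = a 2 7 * d].
Proof.
have [/jacobi_eqsP[J1 J2 J3] [_ [a26 _ _ _]]] := Ua.
have [p0 p1 q0 q1] := image_unipotent.
have x2 l : (l < 7)%N -> x 2 l = [:: 0; 0; 1; q 2; q 3 - a 1 4 * p 2; q 4
    - a 1 4 * p 3 - a 1 5 * p 2; q 5 + a 2 6 * p 4 + a 2 6 * p 2 * q 3
    - a 1 4 * p 4 - a 1 5 * p 3 - a 1 6 * p 2 - a 2 6 * p 3 * q 2]`_l.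
  by do 7?case: l => [|l] //; move=> _; rewrite Ex //= ?p0 ?p1 ?q0 ?q1; ring.
have x3 l : (l < 8)%N -> x 3 l = [:: 0; 0; 0; 1; q 2; q 3 - a 1 4 * p 2; q 4
    + a 2 6 * p 2 * q 2 - a 1 4 * p 3 - a 1 5 * p 2 - a 2 6 * p 3; q 5
    + 2 * a 2 6 * p 2 * q 3 + a 2 7 * p 2 * q 2 - a 1 4 * p 4 - a 1 5 * p 3
    - a 1 6 * p 2 - a 2 7 * p 3 - a 1 4 * a 2 6 * p 2 ^+ 2
    - a 2 6 * p 3 * q 2]`_l.
  by do 8?case: l => [|l] //; move=> _;
    rewrite Ex // (eq_bracket_coordr _ _ x2) //= ?p0 ?p1; ring.
have x4 l : (l < 9)%N -> x 4 l = [:: 0; 0; 0; 0; 1; q 2; q 3 + a 2 6 * p 2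
    - a 1 4 * p 2; q 4 + a 2 7 * p 2 + 2 * a 2 6 * p 2 * q 2 - a 1 4 * p 3
    - a 1 5 * p 2 - a 2 6 * p 3; q 5 + a 2 8 * p 2 + a 1 4 * a 3 8 * p 2 ^+ 2
    + 3 * a 2 6 * p 2 * q 3 + 2 * a 2 7 * p 2 * q 2 + a 3 8 * p 3 * q 2
    - a 1 4 * p 4 - a 1 5 * p 3 - a 1 6 * p 2 - a 2 7 * p 3 - a 3 8 * p 4
    - 2 * a 1 4 * a 2 6 * p 2 ^+ 2 - a 2 6 * p 3 * q 2
    - a 3 8 * p 2 * q 3]`_l.
  by do 9?case: l => [|l] //; move=> _;
    rewrite Ex // (eq_bracket_coordr _ _ x3) //= ?p0 ?p1; ring.
have x5 l : (l < 9)%N -> x 5 l = [:: 0; 0; 0; 0; 0; 1; q 2; q 3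
    + 2 * a 2 6 * p 2 - a 1 4 * p 2; q 4 + 2 * a 2 7 * p 2 + a 3 8 * p 3
    + 3 * a 2 6 * p 2 * q 2 - a 1 4 * p 3 - a 1 5 * p 2 - a 2 6 * p 3
    - a 3 8 * p 2 * q 2]`_l.
  by do 9?case: l => [|l] //; move=> _;
    rewrite Ex // (eq_bracket_coordr _ _ x4) //= ?p0 ?p1; ring.
have x6 l : (l < 10)%N -> x 6 l = [:: 0; 0; 0; 0; 0; 0; 1; q 2; q 3
    + 3 * a 2 6 * p 2 - a 1 4 * p 2 - a 3 8 * p 2; q 4 + 3 * a 2 7 * p 2
    + 2 * a 3 8 * p 3 + a 4 9 * p 4 + 2 * a 2 6 * a 4 9 * p 2 ^+ 2
    + 4 * a 2 6 * p 2 * q 2 + a 4 9 * p 2 * q 3 - a 1 4 * p 3 - a 1 5 * p 2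
    - a 2 6 * p 3 - a 3 9 * p 2 - a 1 4 * a 4 9 * p 2 ^+ 2
    - 3 * a 3 8 * p 2 * q 2 - a 4 9 * p 3 * q 2]`_l.
  by do 10?case: l => [|l] //; move=> _;
    rewrite Ex // (eq_bracket_coordr _ _ x5) //= ?p0 ?p1; ring.
have x7 l : (l < 10)%N -> x 7 l = [:: 0; 0; 0; 0; 0; 0; 0; 1; q 2; q 3
    + 4 * a 2 6 * p 2 + a 4 9 * p 2 * q 2 - a 1 4 * p 2 - 3 * a 3 8 * p 2
    - a 4 9 * p 3]`_l.
  by do 10?case: l => [|l] //; move=> _;
    rewrite Ex // (eq_bracket_coordr _ _ x6) //= ?p0 ?p1; ring.
have x8 l : (l < 10)%N -> x 8 l = [:: 0; 0; 0; 0; 0; 0; 0; 0; 1; q 2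
    + a 4 9 * p 2]`_l.
  by do 10?case: l => [|l] //; move=> _;
    rewrite Ex // (eq_bracket_coordr _ _ x7) //= ?p0 ?p1; ring.
have x9 l : (l < 10)%N -> x 9 l = [:: 0; 0; 0; 0; 0; 0; 0; 0; 0; 1]`_l.
  by do 10?case: l => [|l] //; move=> _;
    rewrite Ex // (eq_bracket_coordr _ _ x8) //= ?p0 ?p1; ring.
have q3 : 2 * q 3 = q 2 ^+ 2.
  have E := @E12 6 isT; rewrite (eq_bracket_coordr _ _ x2) //= q0 q1 in E.
  rewrite x4 // x5 // x6 // x7 // x8 // x9 //= in E.
  by apply: scaled_eq (_ : - a 2 6 != 0) E _; [rewrite oppr_eq0 | ring].
(* Halving q_2 makes q_3 a polynomial in r, which keeps the later identities free of fractions. *)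
have [r q2E q3E] : exists2 r, q 2 = 2 * r & q 3 = 2 * r ^+ 2.
  have nz2 : (2 : K) != 0 by rewrite pnatr_eq0.
  exists (q 2 / 2); first by field.
  by apply: (mulfI nz2); rewrite q3; field.
(* Both vanish for the inner automorphism exp(2 r ad x_0), where q_k = (2r)^(k-1) / (k-1)! for 1 <=
   k <= 5 and p_k = 0 for k >= 2. *)
pose d := 3 * q 4 - 4 * r ^+ 3 - 3 * a 1 4 * p 3 + 6 * a 1 4 * p 2 * r.
pose e := 2 * q 5 - 4 * r * q 4 + 4 * r ^+ 4 - 2 * a 1 4 * p 4
  + 4 * a 1 4 * p 3 * r - 4 * a 1 4 * p 2 * r ^+ 2 - 2 * a 1 5 * p 3
  + 4 * a 1 5 * p 2 * r - a 1 4 ^+ 2 * p 2 ^+ 2.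
have E7 := @E12 7 isT; rewrite (eq_bracket_coordr _ _ x2) //= q0 q1 in E7.
rewrite x4 // x5 // x6 // x7 // x8 // x9 //= q2E q3E in E7.
have tE : t = - (a 2 6 * d).
  by apply: scaled_eq (oner_neq0 _) (esym E7) _; rewrite /d; ring.
exists d, e; split=> //.
  have E := @E23 9 isT; rewrite /= !(x2 0, x2 1, x2 2, x2 3, x2 4, x2 5, x2 6,
    x3 0, x3 1, x3 2, x3 3, x3 4, x3 5, x3 6, x3 7) //= in E.
  rewrite x6 // x7 // x8 // x9 //= q2E q3E in E.
  (* The Jacobi relations absorb the surplus terms, all divisible by p_2; the factor 2 clears halves
     in the multipliers. *)
  have E' := f_equal2 +%R (f_equal2 +%R (congr1 ( *%R 2) E)
    (congr1 ( *%R (a 4 9 * p 2 ^+ 2 + 4 * p 2 * r)) J1))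
    (f_equal2 +%R (congr1 ( *%R (- 2 * p 2)) J2)
    (congr1 ( *%R (- (2 * a 1 4 + a 2 6) * p 2 ^+ 2)) J3)).
  by apply: scaled_eq (_ : (2 : K) != 0) E' _;
    [rewrite pnatr_eq0 | rewrite /d /e; ring].
have E := @E12 8 isT.
rewrite /= q0 q1 !(x2 0, x2 1, x2 2, x2 3, x2 4, x2 5, x2 6) //= in E.
rewrite x4 // x5 // x6 // x7 // x8 // x9 //= q2E q3E tE in E.
have E' := f_equal2 +%R E
  (congr1 ( *%R (p 4 - 2 * p 3 * r + 2 * p 2 * r ^+ 2)) J1).
by apply: scaled_eq (oner_neq0 _) E' _; rewrite /d /e; ring.
Qed.

Lemma shift_eq0 : t = 0.
Proof.
have [/jacobi_eqsP[J1 _ J3] [_ [_ a38 nz1 nz15]]] := Ua.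
have [d [e [-> E9 E8]]] := shift_system.
suff -> : d = 0 by rewrite mulr0 oppr0.
(* Eliminating e leaves the determinant of the system times d. *)
have Ed : (a 3 8 * (a 3 8 - 2 * a 2 6) - a 2 7 * a 4 9) * d = 0.
  have E' := f_equal2 +%R (congr1 ( *%R (- (a 3 8 - 2 * a 2 6))) E9)
    (congr1 ( *%R (a 4 9)) E8).
  by apply: scaled_eq (oner_neq0 _) E' _; ring.
apply/eqP; move/eqP: Ed; rewrite mulf_eq0 => /orP[|//]; apply: contraTT => d0.
have a49 : a 4 9 != 0.
  apply: contraNneq d0 => a49; move/esym/eqP: E9.
  by rewrite a49 mul0r mulf_eq0 (negPf a38).
move/eqP: J3; rewrite mulf_eq0 (negPf a49) /= subr_eq0 => /eqP a38E.
(* With a_{3,8} = 2 a_{1,4} - a_{2,6}, the first Jacobi relation becomes 4 (a_{2,6}^2 - a_{1,4}^2) =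
   0. *)
have : (a 2 6 - a 1 4) * (a 2 6 + a 1 4) = 0.
  by apply: scaled_eq (_ : (4 : K) != 0) J1 _;
    [rewrite pnatr_eq0 | rewrite -a38E; ring].
move/eqP; rewrite mulf_eq0 subr_eq0 addr_eq0.
(* Here a_{3,8} is a_{1,4} in the first case and 3 a_{1,4} in the second. *)
case/orP=> /eqP a26E; rewrite -a38E a26E.
  by apply: contraNneq nz1 => E; rewrite -oppr_eq0 -E; apply/eqP; ring.
by apply: contraNneq nz15 => E; rewrite -E; apply/eqP; ring.
Qed.

End Rigidity.

(** * From an isomorphism to its coordinates, and the theorem *)

Lemma isomorphic_shift_eq0 (K : numFieldType) (a : nat -> nat -> K) (t : K)
    (f : {linear 'rV[K]_10 -> 'rV[K]_10}) :
    U10 a -> injective f ->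
    (forall u v, f (bracket_of a u v + t *: psi_rs 1 7 u v)
                 = bracket_of a (f u) (f v)) ->
  t = 0.
Proof.
move=> Ua inj_f fM; pose x j := entry (f (basis_vec K 10 j)).
have fE u l : entry (f u) l = \sum_(0 <= i < 10) entry u i * x i l.
  rewrite {1}(row_basis_vec u) linear_sum entry_sum.
  by apply: eq_bigr => i _; rewrite linearZ entryZ.
have xE i j l : (l < 10)%N -> bracket_coord a (x i) (x j) l =
    \sum_(0 <= k < 10) bracket_coord (shift17 a t)
      (fun m => (m == i)%:R) (fun m => (m == j)%:R) k * x k l.
  move=> l10; rewrite -entry_bracket_of // -fM fE.
  apply: eq_big_nat => k /andP[_ k10]; rewrite entry_shift17 //; congr (_ * _).
  by apply: (@eq_bracket_coord _ _ 10) => // [m m10|m m10|];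
    rewrite ?entry_basis_vec // ltnW.
have Ex j l : (0 < j < 9)%N -> (l < 10)%N ->
    x j.+1 l = bracket_coord a (x 0) (x j) l.
  move=> hj l10; rewrite -entry_bracket_of // -fM.
  by rewrite (bracket_basis0 (entry_shift17 a t)).
apply: (shift_eq0 Ua Ex) => [l l10|l l10|].
(* Unlocking the big operator lets the sum over the structure constants of mu_t compute. *)
- by rewrite xE // unlock /= /shift17 /=; ring.
- by rewrite xE // unlock /= /shift17 /=; ring.
(* By triangularity f(x_9) is [x 9 9] times x_9, so a zero coefficient would contradict
   injectivity. *)
apply/eqP => x99; have f9 : f (basis_vec K 10 9) = 0.
  apply: entryP => k; rewrite entry0 leq_eqVlt => /predU1P[->|lt_k9] //.
  exact: (image_triangular Ex (j := 9)).
have /(congr1 (@entry _ _ ^~ 9)) := inj_f _ _ (etrans f9 (esym (linear0 f))).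
by rewrite entry_basis_vec // entry0 eqxx => /eqP; rewrite oner_eq0.
Qed.

Theorem proposition5p2 (R : realType) (a : nat -> nat -> R[i]) (ha : U10 a)
    (t : R[i]) :
  let mu : 'rV[R[i]]_10 -> 'rV[R[i]]_10 -> 'rV[R[i]]_10 := bracket_of a in
  let mu_t : 'rV[R[i]]_10 -> 'rV[R[i]]_10 -> 'rV[R[i]]_10 :=
    fun u v => mu u v + t *: psi_rs 1 7 u v in
  filiform_lie_bracket mu_t /\ (lie_isomorphic mu_t mu <-> t = 0).
Proof.
move=> mu mu_t; split.
  apply: (filiform_bracket (entry_shift17 a t)).
  have [/jacobi_eqsP[J1 J2 J3] _] := ha.
  by split; rewrite /shift17 /= !addr0.
split=> [[f [f_bij fM]]|t0].
  exact: (isomorphic_shift_eq0 ha (bij_inj f_bij) fM).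
exists (idfun : {linear _ -> _}); split; first by exists idfun.
by move=> u v; rewrite /mu_t t0 scale0r addr0.
Qed.
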